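(* Let $\alpha,c\in[0,1]$ satisfy $\alpha+c\ge 1$. Then the following hold. (1) Every $n$-vertex triangle-free graph with $cn^2$ edges contains a vertex set of size $\lfloor \alpha n\rfloor$ that spans at most $(2\alpha-1)cn^2$ edges. (2) Assume that $\alpha n\in\mathbb{N}$ and that $G$ is an $n$-vertex triangle-free graph with $cn^2$ edges. If every vertex set of size $\alpha n$ in $G$ spans at least $(2\alpha-1)cn^2$ edges, then $G$ is regular, and vice versa: if $G$ is regular, then every vertex set of size $\alpha n$ in $G$ spans at least $(2\alpha-1)cn^2$ edges.
   Context: All graphs are finite and simple. A vertex set $S$ of a graph $G$ spans $m$ edges if the induced subgraph $G[S]$ has exactly $m$ edges. A graph is triangle-free if it does not contain $K_3$ as a subgraph, and regular if all its vertices have the same degree.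
   Formalization: In part (2), the direction from the spanning condition to regularity is stated only for α < 1: for α = 1 it is false, e.g. the path on three vertices (c = 2/9) satisfies the condition but is not regular. *)

(* Defs.v *)
From mathcomp Require Import all_boot all_order all_algebra.

Set Implicit Arguments.
Unset Strict Implicit.
Unset Printing Implicit Defensive.

Record sgraph (V : finType) := SGraph {
  adj :> rel V;
  adj_sym : symmetric adj;
  adj_irrefl : irreflexive adj }.

Section SimpleGraphs.
Variables (V : finType) (G : sgraph V).

Definition edge_set : {set {set V}} :=
  [set [set p.1; p.2] | p : V * V & G p.1 p.2].

Definition num_edges : nat := #|edge_set|.

(* The number of edges of the induced subgraph G[S]. *)
Definition spanned_edges (S : {set V}) : nat :=
  #|[set e in edge_set | e \subset S]|.

Definition triangle_free : Prop :=
  forall x y z : V, ~ (G x y /\ G y z /\ G x z).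

Definition degree (x : V) : nat := #|[set y | G x y]|.

Definition regular : Prop := forall x y : V, degree x = degree y.

End SimpleGraphs.

(* Main.v *)
(* Call [arcs W W / #|W|] the average degree of the induced subgraph G[W], and
   let W maximise it.  Every vertex of G[W] then has at least half the average
   degree D of G[W] as its degree.  Since the degrees have nonnegative variance,
   some vertex v of W has a neighbourhood in G[W] whose degrees average at least
   D >= 2cn; this neighbourhood has at least cn >= (1 - alpha)n vertices and is
   independent.  Its vertices of largest degree form a set T of the required
   size that meets at least 2(1 - alpha)cn^2 edges, and S is the complement of
   T.  In the extremal case the whole vertex set attains the maximum and every
   neighbourhood has average degree at most D, so the variance vanishes. *)

Require Import Defs.
From mathcomp Require Import all_boot all_order all_algebra.
From mathcomp Require Import reals.
From mathcomp Require Import zify ring lra.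

Set Implicit Arguments.
Unset Strict Implicit.
Unset Printing Implicit Defensive.

Import Order.TTheory GRing.Theory Num.Theory.
Local Open Scope ring_scope.

(** * Subsets of large average *)

(** Discarding a minimal element never lowers the average, so elements are shed until [m] are
    left. *)
Lemma exists_subset_average_le (R : realFieldType) (T : finType) (f : T -> R)
    (A : {set T}) (m : nat) :
  (m <= #|A|)%N ->
  exists B : {set T}, [/\ B \subset A, #|B| = m &
    m%:R * (\sum_(x in A) f x) <= #|A|%:R * \sum_(x in B) f x].
Proof.
move=> lemA; set s := \sum_(x in A) f x.
(* The scaled deviations [g] sum to zero over [A]; the claim becomes that their sum over [B] is
   nonnegative. *)
pose g x := #|A|%:R * f x - s.
have sumg (B : {set T}) :
    \sum_(x in B) g x = #|A|%:R * (\sum_(x in B) f x) - #|B|%:R * s.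
  by rewrite sumrB -mulr_sumr sumr_const -[s *+ _]mulr_natl.
have shed k : (m + k <= #|A|)%N -> exists B : {set T},
    [/\ B \subset A, #|B| = (#|A| - k)%N & 0 <= \sum_(x in B) g x].
  elim: k => [|k IHk] lek.
    by exists A; rewrite subn0 sumg subrr.
  have [|B [sBA cardB geB]] := IHk; first by lia.
  have [x0 x0B] : exists x, x \in B by apply/card_gt0P; lia.
  have [x /= xB minx] := @arg_minP _ R T x0 [in B] g x0B.
  exists (B :\ x); split.
  - exact: subset_trans (subD1set _ _) sBA.
  - by move: (cardsD1 x B); rewrite xB; lia.
  - have eqB : \sum_(y in B) g y = g x + \sum_(y in B :\ x) g y.
      exact: big_setD1.
    have [gx0|gx0] := leP (g x) 0; first by move: geB; rewrite eqB; lra.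
    apply: sumr_ge0 => y; rewrite in_setD1 => /andP[_ yB].
    exact: le_trans (ltW gx0) (minx _ yB).
have [|B [sBA cardB geB]] := shed (#|A| - m)%N; first by lia.
exists B; split=> //; first by lia.
by move: geB; rewrite sumg cardB subKn // subr_ge0.
Qed.

(** * Counting edges by ordered adjacent pairs *)

Section Arcs.
Variables (V : finType) (G : sgraph V).

Definition arcs (A B : {set V}) : nat := \sum_(x in A) \sum_(y in B) G x y.

Definition degree_in (A : {set V}) (x : V) : nat := \sum_(y in A) G x y.

Lemma degree_inE A x : degree_in A x = #|[set y in A | G x y]|.
Proof.
rewrite /degree_in -sum1_card big_mkcond [RHS]big_mkcond /=.
by apply: eq_bigr => y _; rewrite inE; case: (y \in A) (G x y) => [] [].
Qed.

Lemma degree_in_setT x : degree_in setT x = degree G x.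
Proof.
by rewrite degree_inE /degree; apply: eq_card => y; rewrite !inE.
Qed.

Lemma leq_degree_in A x : (degree_in A x <= degree G x)%N.
Proof.
rewrite degree_inE; apply: subset_leq_card; apply/subsetP => y.
by rewrite !inE => /andP[].
Qed.

Lemma arcsC A B : arcs A B = arcs B A.
Proof.
rewrite /arcs exchange_big /=; apply: eq_bigr => x _.
by apply: eq_bigr => y _; rewrite adj_sym.
Qed.

Lemma arcs_setCr A B : arcs A setT = (arcs A B + arcs A (~: B))%N.
Proof.
rewrite /arcs -big_split /=; apply: eq_bigr => x _.
rewrite (bigID (mem B)) /=; congr addn; apply: eq_bigl => y; by rewrite !inE.
Qed.

(** Twice the degree sum counts the arcs that start in [A] and those that end in [A], hence the arcs
    inside [A] twice. *)
Lemma arcs_setC A :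
  (arcs (~: A) (~: A) + 2 * \sum_(x in A) degree G x
    = arcs setT setT + arcs A A)%N.
Proof.
have -> : (\sum_(x in A) degree G x = arcs A setT)%N.
  by apply: eq_bigr => x _; rewrite -degree_in_setT.
have := arcs_setCr setT A; have := arcs_setCr A A.
have := arcs_setCr (~: A) A.
by rewrite (arcsC setT A) (arcsC setT (~: A)) (arcsC (~: A) A); lia.
Qed.

Lemma arcs_setD1 (A : {set V}) x : x \in A ->
  arcs A A = (arcs (A :\ x) (A :\ x) + 2 * degree_in A x)%N.
Proof.
move=> xA; rewrite {1}/arcs (big_setD1 x xA) /= -/(degree_in A x).
have -> : (\sum_(y in A :\ x) \sum_(z in A) G y z
    = arcs (A :\ x) (A :\ x) + \sum_(y in A :\ x) G x y)%N.
  rewrite /arcs -big_split; apply: eq_bigr => y _ /=.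
  by rewrite (big_setD1 x xA) /= adj_sym addnC.
have -> : (\sum_(y in A :\ x) G x y = degree_in A x)%N.
  by rewrite /degree_in [RHS](big_setD1 x xA) /= adj_irrefl.
lia.
Qed.

(** Arcs inside [S] are grouped by their underlying edge; without loops, each group has exactly two
    members. *)
Lemma double_spanned_edges (S : {set V}) :
  (2 * spanned_edges G S = arcs S S)%N.
Proof.
pose P (p : V * V) := [&& p.1 \in S, p.2 \in S & G p.1 p.2].
pose E := [set e in edge_set G | e \subset S].
have -> : arcs S S = (\sum_(p | P p) 1)%N.
  rewrite /arcs pair_big_dep /= (bigID (fun p : V * V => G p.1 p.2)) /=.
  rewrite [X in (_ + X)%N]big1 ?addn0 => [|p /andP[_ /negPf->] //].
  apply: eq_big => [p|p /andP[_ ->] //]; by rewrite /P andbA.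
rewrite (partition_big (fun p => [set p.1; p.2]) (mem E)) /=; last first.
  move=> [x y] /= /and3P[/= xS yS Gxy]; rewrite !inE subUset !sub1set xS yS.
  by rewrite !andbT; apply/imsetP; exists (x, y); rewrite ?inE.
rewrite (eq_bigr (fun=> 2%N)) => [|e].
  by rewrite sum_nat_const mulnC.
rewrite !inE => /andP[/imsetP[[x y] /= Gxy ->]].
rewrite subUset !sub1set => /andP[xS yS].
have nxy : x != y by apply/eqP=> eqxy; move: Gxy; rewrite inE /= eqxy adj_irrefl.
rewrite inE /= in Gxy.
rewrite (eq_bigl (mem [set (x, y); (y, x)])) => [|[u v]].
  by rewrite sum1_card cards2 xpair_eqE (negPf nxy).
rewrite !inE /P /=; apply/andP/idP => [[/and3P[uS vS Guv]] /eqP eqS|].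
  have := set21 u v; have := set22 u v; rewrite eqS !inE !xpair_eqE.
  have nuv : u != v by apply/eqP=> equv; move: Guv; rewrite equv adj_irrefl.
  move=> /orP[]/eqP ev /orP[]/eqP eu; move: nuv; rewrite eu ev !eqxx //=.
  by rewrite orbT.
case/orP=> /eqP[-> ->]; rewrite xS yS ?(adj_sym G y x) Gxy //.
by rewrite setUC.
Qed.

Lemma spanned_edges_setT : spanned_edges G setT = num_edges G.
Proof. by apply: eq_card => e; rewrite !inE subsetT andbT. Qed.

Lemma arcs_subset_neighbors (v : V) (T : {set V}) :
  triangle_free G -> T \subset [set u | G v u] -> arcs T T = 0%N.
Proof.
move=> tf /subsetP sT; rewrite /arcs big1 // => x /sT; rewrite inE => Gvx.
rewrite big1 // => y /sT; rewrite inE => Gvy.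
by apply/eqP; rewrite eqb0; apply/negP => Gxy; apply: (tf v x y).
Qed.

End Arcs.

(** * Densest vertex sets *)

Section Density.
Variables (R : realFieldType) (V : finType) (G : sgraph V).

Definition density (W : {set V}) : R := (arcs G W W)%:R / #|W|%:R.

Definition densest (W : {set V}) : Prop :=
  W != set0 /\ forall U : {set V}, U != set0 -> density U <= density W.

Lemma densest_exists : (0 < #|V|)%N -> exists W, densest W.
Proof.
move=> V0; have T0 : [set: V] != set0 by rewrite -card_gt0 cardsT.
have [W W0 maxW] := @arg_maxP _ R {set V} [set: V] (fun U => U != set0) density T0.
by exists W; split.
Qed.

Lemma densityE (W : {set V}) : W != set0 -> density W * #|W|%:R = (arcs G W W)%:R.
Proof. by move=> W0; rewrite divfK // pnatr_eq0 -lt0n card_gt0. Qed.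

(* Deleting a vertex of degree less than half the density would raise the density. *)
Lemma densest_degree (W : {set V}) (x : V) :
  densest W -> x \in W -> density W <= 2 * (degree_in G W x)%:R.
Proof.
move=> [W0 maxW] xW.
have := densityE W0.
rewrite (arcs_setD1 G xW) (cardsD1 x W) xW [X in _ * X = _]natrD [RHS]natrD natrM.
(* If [W] is just [x], maximality says nothing about the empty remainder, but the identity gives the
   bound directly. *)
have [/eqP D0|D0] := boolP (W :\ x == set0).
  rewrite D0 cards0 /arcs big_set0 /=; lra.
have := maxW _ D0; have := densityE D0.
have : 0 < #|W :\ x|%:R :> R by rewrite ltr0n card_gt0.
move: (density W) (density _) => a b; rewrite mulr1n; nra.
Qed.

(* Double counting: a vertex [u] occurs in [degree_in G W u] neighbourhoods,
   and the deviations of the degrees from their mean sum to zero. *)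
Lemma sum_neighbor_deviation (W : {set V}) : W != set0 ->
  \sum_(v in W) \sum_(u in [set u in W | G v u])
      ((degree_in G W u)%:R - density W)
    = \sum_(u in W) ((degree_in G W u)%:R - density W) ^+ 2.
Proof.
move=> W0; set d := density W.
pose h u : R := (degree_in G W u)%:R - d.
have h0 : \sum_(u in W) h u = 0.
  by rewrite sumrB sumr_const -natr_sum -/(arcs G W W) -densityE // mulr_natr subrr.
transitivity (\sum_(v in W) \sum_(u in W) h u * (G v u)%:R).
  apply: eq_bigr => v _; rewrite big_mkcond [RHS]big_mkcond /=.
  apply: eq_bigr => u _; rewrite inE.
  by case: (u \in W) (G v u) => [] []; rewrite /= ?mulr1 ?mulr0.
rewrite exchange_big /=.
(* The weight of [u] is now its degree [h u + d], and the linear part sums to zero by [h0]. *)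
transitivity (\sum_(u in W) (h u ^+ 2 + d * h u)).
  apply: eq_bigr => u _; rewrite -mulr_sumr.
  have -> : \sum_(v in W) (G v u)%:R = (degree_in G W u)%:R :> R.
    by rewrite natr_sum; apply: eq_bigr => v _; rewrite adj_sym.
  by rewrite /h; ring.
by rewrite big_split /= -mulr_sumr h0 mulr0 addr0.
Qed.

(** * Heavy independent sets *)

(** The hypothesis on [m] bounds it by half the density rounded up, so the neighbourhood [A] has at
    least [m] vertices to choose [T] from. *)
Lemma heavy_independent_set_in (W : {set V}) (v : V) (m : nat) :
  triangle_free G -> densest W -> v \in W ->
  (forall d : nat, density W <= 2 * d%:R -> (m <= d)%N) ->
  let A := [set u in W | G v u] in
  exists T : {set V}, [/\ #|T| = m, arcs G T T = 0%N &
    m%:R * (\sum_(u in A) (degree_in G W u)%:R)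
      <= #|A|%:R * \sum_(x in T) (degree G x)%:R :> R].
Proof.
move=> tf dW vW mP A.
have lemA : (m <= #|A|)%N by rewrite -degree_inE; apply/mP/densest_degree.
have [T [sTA cT leT]] :=
  exists_subset_average_le (fun u => (degree_in G W u)%:R : R) lemA.
exists T; split=> //.
  apply: (@arcs_subset_neighbors _ _ v) => //; apply: subset_trans sTA _.
  by apply/subsetP => u; rewrite !inE => /andP[].
apply: le_trans leT _; rewrite ler_wpM2l // ler_sum // => u _.
by rewrite ler_nat leq_degree_in.
Qed.

Lemma heavy_independent_set (W : {set V}) (m : nat) :
  triangle_free G -> densest W -> (0 < m)%N ->
  (forall d : nat, density W <= 2 * d%:R -> (m <= d)%N) ->
  exists T : {set V}, [/\ #|T| = m, arcs G T T = 0%N &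
    m%:R * density W <= \sum_(x in T) (degree G x)%:R].
Proof.
move=> tf dW m0 mP.
pose A v := [set u in W | G v u].
(* The deviation sums add up to a sum of squares, so they cannot all be negative. *)
have [v vW vP] : exists2 v, v \in W &
    0 <= \sum_(u in A v) ((degree_in G W u)%:R - density W).
  apply/exists_inP; apply: contraT; rewrite negb_exists_in => /forall_inP neg.
  have [v0 v0W] := set0Pn _ dW.1.
  have : 0 <= \sum_(v in W) \sum_(u in A v) ((degree_in G W u)%:R - density W).
    by rewrite sum_neighbor_deviation ?dW.1 // sumr_ge0 // => u _; exact: sqr_ge0.
  rewrite leNgt (big_setD1 v0 v0W) /=; case/negP.
  rewrite -[ltRHS]addr0 ltr_leD // ?ltNge ?neg //.
  apply: sumr_le0 => v; rewrite inE => /andP[_ vW].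
  by apply: ltW; rewrite ltNge neg.
have [T [cT iT leT]] := heavy_independent_set_in tf dW vW mP.
exists T; split=> //.
have A0 : 0 < #|A v|%:R :> R.
  rewrite ltr0n; apply: leq_trans m0 _; apply: mP.
  by rewrite -degree_inE; apply: densest_degree.
rewrite -(ler_pM2l A0); apply: le_trans leT.
rewrite mulrCA ler_wpM2l //.
by move: vP; rewrite sumrB sumr_const subr_ge0 mulr_natl.
Qed.

Lemma regular_of_independent_sums_le (m : nat) :
  triangle_free G -> (0 < m)%N ->
  (forall d : nat, density setT <= 2 * d%:R -> (m <= d)%N) ->
  (forall T : {set V}, #|T| = m -> arcs G T T = 0%N ->
     \sum_(x in T) (degree G x)%:R <= m%:R * density setT) ->
  regular G.
Proof.
move=> tf m0 mP H x y.
have V0 : (0 < #|V|)%N by apply/card_gt0P; exists x.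
have T0 : [set: V] != set0 by rewrite -card_gt0 cardsT.
have mR : 0 < m%:R :> R by rewrite ltr0n.
(* By [H], the heavy independent set found in a densest [W] forces the density of [W] to be at most
   that of the whole graph. *)
have dT : densest setT.
  have [W dW] := densest_exists V0.
  have [|T [cT iT leT]] := heavy_independent_set tf dW m0.
    by move=> d dP; apply/mP/(le_trans _ dP)/dW.2.
  have := le_trans leT (H _ cT iT); rewrite ler_pM2l // => leW.
  by split=> // U U0; apply: le_trans leW; apply: dW.2.
(* A heavier neighbourhood would contain a set [T] violating [H]. *)
have devle v : \sum_(u in [set u in setT | G v u])
    ((degree_in G setT u)%:R - density setT) <= 0.
  have [T [cT iT leT]] := heavy_independent_set_in tf dT (in_setT v) mP.
  rewrite sumrB sumr_const subr_le0 -mulr_natl -(ler_pM2l mR).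
  by apply: le_trans leT _; rewrite mulrCA ler_wpM2l // H.
(* The sum of squares equals a sum of nonpositive terms, so every square vanishes. *)
have devP u : (degree G u)%:R = density setT.
  have /eqP : \sum_(u in setT) ((degree_in G setT u)%:R - density setT) ^+ 2 = 0.
    apply/eqP; rewrite eq_le sumr_ge0 ?andbT => [|z _]; last exact: sqr_ge0.
    by rewrite -sum_neighbor_deviation // sumr_le0.
  rewrite psumr_eq0 => [|z _]; last exact: sqr_ge0.
  move=> /allP /(_ u); rewrite mem_index_enum => /(_ isT).
  by rewrite in_setT /= sqrf_eq0 subr_eq0 degree_in_setT => /eqP.
by apply/eqP; rewrite -(eqr_nat R) !devP.
Qed.

Lemma spanned_edges_setC (T : {set V}) :
  (spanned_edges G (~: T))%:R
    = (num_edges G)%:R - \sum_(x in T) (degree G x)%:R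
      + (arcs G T T)%:R / 2 :> R.
Proof.
have e (A : {set V}) : (arcs G A A)%:R = 2 * (spanned_edges G A)%:R :> R.
  by rewrite -double_spanned_edges natrM.
have : (arcs G (~: T) (~: T))%:R + 2 * \sum_(x in T) (degree G x)%:R
    = (arcs G setT setT)%:R + (arcs G T T)%:R :> R.
  by rewrite -natr_sum -natrM -!natrD arcs_setC.
rewrite !e spanned_edges_setT; lra.
Qed.

Lemma density_setT : (0 < #|V|)%N ->
  density setT * #|V|%:R = 2 * (num_edges G)%:R.
Proof.
move=> V0; rewrite -cardsT densityE -?card_gt0 ?cardsT //.
by rewrite -double_spanned_edges natrM spanned_edges_setT.
Qed.

End Density.

(* The assumption alpha < 1 in the first half of part (2) is needed: for
   alpha = 1 the only vertex set of size alpha * n is the whole vertex set,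
   so the spanning condition holds for every graph, regular or not. *)
Theorem theorem1p5 (R : realType) (alpha c : R)
    (halpha : 0 <= alpha <= 1) (hc : 0 <= c <= 1) (hac : 1 <= alpha + c) :
  (forall (n : nat) (V : finType) (G : sgraph V),
     #|V| = n -> triangle_free G -> (num_edges G)%:R = c * n%:R ^+ 2 ->
     exists S : {set V},
       #|S|%:Z = Num.floor (alpha * n%:R) /\
       (spanned_edges G S)%:R <= (2 * alpha - 1) * c * n%:R ^+ 2)
  /\
  (forall (n : nat) (V : finType) (G : sgraph V),
     alpha * n%:R \is a Num.nat ->
     #|V| = n -> triangle_free G -> (num_edges G)%:R = c * n%:R ^+ 2 ->
     (alpha < 1 ->
      (forall S : {set V}, #|S|%:R = alpha * n%:R ->
         (2 * alpha - 1) * c * n%:R ^+ 2 <= (spanned_edges G S)%:R) ->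
      regular G)
     /\
     (regular G ->
      forall S : {set V}, #|S|%:R = alpha * n%:R ->
        (2 * alpha - 1) * c * n%:R ^+ 2 <= (spanned_edges G S)%:R)).
Proof.
have [/andP[a0 a1] /andP[c0 c1]] := (halpha, hc).
have dens (n : nat) (V : finType) (G : sgraph V) : (0 < n)%N -> #|V| = n ->
    (num_edges G)%:R = c * n%:R ^+ 2 -> density R G setT = 2 * c * n%:R.
  move=> n0 cV eG; have n0R : n%:R != 0 :> R by rewrite pnatr_eq0 -lt0n.
  apply: (mulIf n0R); rewrite -{1}cV density_setT ?cV // eG; ring.
(* As [alpha + c >= 1], [n <= alpha * n + c * n < k + 1 + d]. The strict bound by [k.+1] serves both
   the rounded and the exact value of [alpha * n]. *)
have sizeP (n k : nat) (D : R) (d : nat) : alpha * n%:R < k.+1%:R ->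
    2 * c * n%:R <= D -> D <= 2 * d%:R -> (n - k <= d)%N.
  move=> ltk leD led; have n0 : 0 <= n%:R :> R by [].
  have : n%:R < (d + k.+1)%:R :> R by rewrite natrD; nra.
  by rewrite ltr_nat; lia.
split=> [n V G cV tf eG | n V G anN cV tf eG].
  have an0 : 0 <= alpha * n%:R by rewrite mulr_ge0.
  have [k floorE] : exists k : nat, Num.floor (alpha * n%:R) = k%:Z.
    by exists `|Num.floor (alpha * n%:R)|%N; rewrite gez0_abs // floor_ge0.
  have /andP[lek ltk] := floor_itv (alpha * n%:R).
  rewrite floorE -?pmulrn ?addn1 in lek ltk.
  have lekn : (k <= n)%N.
    by rewrite -(ler_nat R); apply: le_trans lek _; rewrite ler_piMl.
  suff [T [cT iT leT]] : exists T : {set V}, [/\ #|T| = (n - k)%N,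
      arcs G T T = 0%N & (n - k)%:R * (2 * c * n%:R)
                           <= \sum_(x in T) (degree G x)%:R :> R].
    exists (~: T); split.
      by rewrite cardsCs setCK cV cT subKn // floorE.
    rewrite spanned_edges_setC iT mul0r addr0 eG.
    (* Rounding [alpha * n] down to [k] only enlarges [T], which lowers the bound on the edges
       left. *)
    have : 0 <= c * n%:R * (alpha * n%:R - k%:R).
      by rewrite !mulr_ge0 ?subr_ge0.
    move: leT; rewrite natrB //; lra.
  have [m0|m0] := posnP (n - k)%N.
    exists set0; rewrite cards0 m0 mul0r big_set0; split=> //.
    by rewrite /arcs big_set0.
  have n0 : (0 < n)%N by lia.
  have [|W dW] := densest_exists R G; first by rewrite cV.
  have leD : 2 * c * n%:R <= density R G W.
    by rewrite -(dens n V G) //; apply: dW.2; rewrite -card_gt0 cardsT cV.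
  have [d|T [cT iT leT]] := heavy_independent_set tf dW m0; first exact: sizeP.
  by exists T; split=> //; apply: le_trans leT; rewrite ler_wpM2l.
split=> [a_lt1 H | regG S cS].
  have [n0|n0] := posnP n.
    by move=> x; have := card0_eq (etrans cV n0) x.
  have [k kE] := natrP anN.
  have nR : 0 < n%:R :> R by rewrite ltr0n.
  have ltkn : (k < n)%N by rewrite -(ltr_nat R) -kE gtr_pMl.
  have denG := dens n V G n0 cV eG.
  apply: (@regular_of_independent_sums_le R V G (n - k)) => //.
  - by rewrite subn_gt0.
  - by move=> d; apply: sizeP; rewrite ?denG // kE ltr_nat.
  (* The complement of [T] has size [alpha * n], so its guaranteed edges cap the degree sum of
     [T]. *)
  - move=> T cT iT; have := H (~: T).
    rewrite cardsCs setCK cV cT subKn ?(ltnW ltkn) // kE => /(_ erefl).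
    rewrite spanned_edges_setC iT mul0r addr0 eG denG natrB ?(ltnW ltkn) // -kE.
    lra.
have [n0|n0] := posnP n; first by rewrite n0 expr0n mulr0.
have nR : 0 < n%:R :> R by rewrite ltr0n.
have degE x : (degree G x)%:R = 2 * c * n%:R :> R.
  rewrite -(dens n V G) //; apply: (mulIf (lt0r_neq0 nR)).
  rewrite -[in RHS]cV -cardsT densityE; last by rewrite -card_gt0 cardsT cV.
  rewrite /arcs (eq_bigr (fun=> degree G x)) => [|y _].
    by rewrite sum_nat_const cardsT cV natrM mulrC.
  by rewrite -(regG y x) -degree_in_setT.
have cC : #|~: S|%:R = n%:R - alpha * n%:R :> R.
  by rewrite cardsCs setCK natrB ?max_card // cV cS.
have sumE : \sum_(x in ~: S) (degree G x)%:R
    = (n%:R - alpha * n%:R) * (2 * c * n%:R) :> R.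
  by rewrite (eq_bigr _ (fun x _ => degE x)) sumr_const -[LHS]mulr_natl cC.
rewrite -(setCK S) spanned_edges_setC sumE eG.
(* Edges inside the complement of [S] are subtracted twice by the degree sum, so they only help. *)
have : 0 <= (arcs G (~: S) (~: S))%:R :> R by [].
lra.
Qed.
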